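(* Let $n \ge 1$, let $G$ be any graph on the vertex set $[n]$, and let $w_G(0) \in \mathbb{Z}^n$ be any initial configuration. Then the sequence $(w_G(t))_{t \ge 0}$ of configurations of the diffusion process on $G$ started from $w_G(0)$ is eventually periodic with period either $1$ or $2$; that is, there exist $p \in \{1,2\}$ and an integer $T \ge 0$ such that $w_G(t+p) = w_G(t)$ for all integers $t \ge T$.
   Context: Graphs are finite, simple and undirected, and $[n] = \{1,2,\dots,n\}$. The diffusion process on a graph $G$ with vertex set $[n]$ from an initial configuration $w_G(0) = (w_1(0),\dots,w_n(0)) \in \mathbb{Z}^n$ is defined as follows. For each integer $t \ge 0$ and each vertex $v \in [n]$, let $A_v(t)$ be the number of neighbours $u$ of $v$ in $G$ with $w_u(t) > w_v(t)$, and let $B_v(t)$ be the number of neighbours $u$ of $v$ in $G$ with $w_u(t) < w_v(t)$. All labels are updated simultaneously by $$w_v(t+1) = w_v(t) + A_v(t) - B_v(t).$$ Write $w_G(t) = (w_1(t), w_2(t), \dots, w_n(t)) \in \mathbb{Z}^n$. (Labels may be negative.) *)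

(* Defs.v *)
From mathcomp Require Import all_boot all_order all_algebra.

Set Implicit Arguments.
Unset Strict Implicit.
Unset Printing Implicit Defensive.

Import Order.TTheory GRing.Theory Num.Theory.
Local Open Scope ring_scope.

(* A simple graph on n vertices is given by its adjacency relation, a symmetric
   and irreflexive e : rel 'I_n. The vertex set {1, ..., n} is rendered as
   'I_n = {0, ..., n-1}. *)

Definition config (n : nat) := {ffun 'I_n -> int}.

Section Diffusion.

Variables (n : nat) (e : rel 'I_n).

Definition richer_nbrs (w : config n) (v : 'I_n) : {set 'I_n} :=
  [set u | e v u & w v < w u].

Definition poorer_nbrs (w : config n) (v : 'I_n) : {set 'I_n} :=
  [set u | e v u & w u < w v].

Definition diffusion_step (w : config n) : config n :=
  [ffun v => w v + #|richer_nbrs w v|%:Z - #|poorer_nbrs w v|%:Z].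

Definition diffusion (w0 : config n) (t : nat) : config n :=
  iter t diffusion_step w0.

End Diffusion.

(* Main.v *)
(* Write w_t for the configuration at time t and d_t(v) for the sum of
   sg(w_t(u) - w_t(v)) over the neighbours u of v, so that
   w_(t+1) = w_t + d_t.  The potential P_t = <w_t, w_(t+1)> satisfies
   P_t - P_(t+1) = - <w_(t+1), d_t + d_(t+1)>, and twice this is, by symmetry
   of the graph, a sum over ordered edges of terms (sg y' + sg y) y' >= 0, where
   y and y' are the differences along the edge at times t and t+1.  Since
   4 P_t = |2 w_t + d_t|^2 - |d_t|^2 is bounded below, P_t is eventually
   constant; from then on every edge difference either changes sign or becomes
   zero at each step.  Hence an edge with difference zero keeps it forever, so
   the set of edges with nonzero difference also stabilises, after which
   d_(t+1) = - d_t, i.e. w_(t+2) = w_t. *)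
Require Import Defs.
From mathcomp Require Import all_boot all_order all_algebra.
From mathcomp Require Import ring zify.
From Stdlib Require Import Classical.

Set Implicit Arguments.
Unset Strict Implicit.
Unset Printing Implicit Defensive.

Import Order.TTheory GRing.Theory Num.Theory.
Local Open Scope ring_scope.

(** Induction on a strict bound for [f 0]: unless [f] is constant, it drops strictly at some [s],
    and the sequence restarted at [s.+1] begins lower. *)
Lemma nonincreasing_nat_stable (f : nat -> nat) :
  (forall t, (f t.+1 <= f t)%N) ->
  exists T, forall t, (T <= t)%N -> f t.+1 = f t.
Proof.
move: {2}(f 0%N).+1 (ltnSn (f 0%N)) => k.
elim: k f => [//|k IHk] f f0 fS.
have [fC|/not_all_ex_not[s fs]] := classic (forall t, f t.+1 = f t).
  by exists 0%N => t _; apply: fC.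
have f_le t : (f t <= f 0)%N.
  by elim: t => // t; apply: leq_trans.
have lts : (f (0 + s.+1) < k)%N by rewrite add0n; move: (fS s) (f_le s); lia.
have [//|T fT] := IHk (fun t => f (t + s.+1)%N) lts.
  by move=> t; rewrite addSn.
exists (T + s.+1)%N => t leTt.
have := fT (t - s.+1)%N; rewrite addSn subnK; last by lia.
by apply; lia.
Qed.

Lemma nonincreasing_int_stable (f : nat -> int) (c : int) :
  (forall t, c <= f t) -> (forall t, f t.+1 <= f t) ->
  exists T, forall t, (T <= t)%N -> f t.+1 = f t.
Proof.
move=> fc fS.
have [|T fT] := @nonincreasing_nat_stable (fun t => `|f t - c|%N).
  by move=> t; move: (fc t.+1) (fc t) (fS t); lia.
by exists T => t /fT; move: (fc t.+1) (fc t); lia.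
Qed.

Section Diffusion.

Variables (n : nat) (e : rel 'I_n).

Definition drift (w : config n) (v : 'I_n) : int :=
  \sum_(u | e v u) Num.sg (w u - w v).

Lemma diffusion_stepE w v : diffusion_step e w v = w v + drift w v.
Proof.
rewrite ffunE -addrA; congr (_ + _).
have cardE (A : {set 'I_n}) : #|A|%:Z = \sum_u (u \in A)%:Z.
  rewrite -sum1_card big_mkcond (big_morph Posz PoszD (erefl _)).
  by apply: eq_bigr => u _; case: (u \in A).
rewrite !cardE -sumrB /drift [RHS]big_mkcond; apply: eq_bigr => u _.
rewrite !inE; case: (e v u) => //=.
by case: (ltgtP (w v) (w u)) => h; case: sgrP; lia.
Qed.

Lemma drift_bound w v : `|drift w v| <= n%:Z.
Proof.
apply: le_trans (ler_norm_sum _ _ _) _.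
apply: (@le_trans _ _ (\sum_(u : 'I_n) 1)); last by rewrite sumr_const card_ord; lia.
rewrite big_mkcond; apply: ler_sum => u _.
by case: (e v u) => //; rewrite normr_sg; case: (_ == _).
Qed.

Hypothesis e_sym : symmetric e.

(** Summation by parts on the graph: swapping the two ends of an edge flips the sign of
    [Num.sg (w u - w v)], so both ends contribute equally. *)
Lemma drift_pairing w (x : config n) :
  (\sum_v x v * drift w v) *+ 2 =
  - \sum_v \sum_(u | e v u) Num.sg (w u - w v) * (x u - x v).
Proof.
have swap : \sum_v \sum_(u | e v u) Num.sg (w u - w v) * x u =
            - \sum_v x v * drift w v.
  rewrite (exchange_big_dep xpredT) //= -sumrN; apply: eq_bigr => u _.
  rewrite mulr_sumr -sumrN; apply: eq_big => [v|v _]; first exact: e_sym.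
  by rewrite -opprB sgrN mulNr mulrC.
have same : \sum_v \sum_(u | e v u) Num.sg (w u - w v) * x v =
            \sum_v x v * drift w v.
  by apply: eq_bigr => v _; rewrite mulr_sumr; apply: eq_bigr => u _; rewrite mulrC.
transitivity (- (- \sum_v x v * drift w v - \sum_v x v * drift w v)); first by ring.
rewrite -{1}swap -same -sumrB; congr (- _); apply: eq_bigr => v _.
by rewrite -sumrB; apply: eq_bigr => u _; rewrite mulrBr.
Qed.

Definition potential (w : config n) : int :=
  \sum_v w v * diffusion_step e w v.

Lemma potential_bound w : - (\sum_(v : 'I_n) n%:Z ^+ 2) <= potential w.
Proof.
rewrite -sumrN; apply: ler_sum => v _; rewrite diffusion_stepE.
have := drift_bound w v; rewrite ler_norml => /andP[].
by move: (w v) (drift w v) => a d h1 h2; have := sqr_ge0 (a *+ 2 + d); nia.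
Qed.

Lemma potential_drop w (w' := diffusion_step e w) :
  (potential w - potential w') *+ 2 =
  \sum_v \sum_(u | e v u)
    (Num.sg (w' u - w' v) + Num.sg (w u - w v)) * (w' u - w' v).
Proof.
(* Both potentials contain [w'] as a factor: substitute [w = w' - drift w] in the first and expand
   the step from [w'] in the second; the squares of [w'] cancel. *)
have -> : potential w - potential w' =
    - (\sum_v w' v * drift w' v + \sum_v w' v * drift w v).
  rewrite -big_split /potential -sumrB -sumrN; apply: eq_bigr => v _ /=.
  by rewrite (diffusion_stepE w' v) /w' (diffusion_stepE w v); ring.
rewrite mulNrn mulrnDl !drift_pairing -opprD opprK -big_split.
by apply: eq_bigr => v _; rewrite -big_split; apply: eq_bigr => u _; rewrite mulrDl.
Qed.

(** [Num.sg y * y] is the absolute value of [y], which dominates [Num.sg x * y]. *)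
Lemma sg_add_mul_ge0 (x y : int) : 0 <= (Num.sg y + Num.sg x) * y.
Proof. by case: (sgrP y); case: (sgrP x); nia. Qed.

Lemma potential_le w : potential (diffusion_step e w) <= potential w.
Proof.
rewrite -subr_ge0 -(@pmulrn_lge0 _ _ 2) // potential_drop.
by apply: sumr_ge0 => v _; apply: sumr_ge0 => u _; apply: sg_add_mul_ge0.
Qed.

(** A zero drop is a vanishing sum of nonnegative edge terms, so each term is zero; a nonzero
    difference then forces the sign factor to vanish. *)
Lemma potential_eq_alternates w (w' := diffusion_step e w) u v :
  potential w' = potential w -> e v u ->
  w' u != w' v -> Num.sg (w' u - w' v) = - Num.sg (w u - w v).
Proof.
move=> eq_pot evu; have := potential_drop w; rewrite /= -/w' eq_pot subrr mul0rn.
move/esym/eqP; rewrite psumr_eq0 => [/allP/(_ v)|x _]; last first.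
  by apply: sumr_ge0 => z _; apply: sg_add_mul_ge0.
rewrite mem_index_enum => /(_ isT)/=.
rewrite psumr_eq0 => [/allP/(_ u)|x _]; last exact: sg_add_mul_ge0.
rewrite mem_index_enum => /(_ isT)/implyP/(_ evu).
by rewrite mulf_eq0 addr_eq0 subr_eq0 => /orP[/eqP|->].
Qed.

Definition active_edges (w : config n) : {set 'I_n * 'I_n} :=
  [set p | e p.1 p.2 & w p.2 != w p.1].

Lemma potential_eq_active w :
  potential (diffusion_step e w) = potential w ->
  active_edges (diffusion_step e w) \subset active_edges w.
Proof.
move=> eq_pot; apply/subsetP => -[v u]; rewrite !inE /= => /andP[evu neq'].
rewrite evu /=; have := potential_eq_alternates eq_pot evu neq'.
(* Were the old difference zero, alternation would make the new one zero too. *)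
apply: contra_eq_neq => ->; rewrite subrr sgr0 oppr0 sgr_eq0 subr_eq0.
by rewrite neq'.
Qed.

(** The two drifts cancel edge by edge: signs alternate on active edges, and equality of the active
    sets makes both signs zero on the others. *)
Lemma active_eq_period2 w :
  potential (diffusion_step e w) = potential w ->
  active_edges (diffusion_step e w) = active_edges w ->
  diffusion_step e (diffusion_step e w) = w.
Proof.
set w' := diffusion_step e w => eq_pot eqA; apply/ffunP => v.
rewrite !diffusion_stepE -addrA -[RHS]addr0; congr (_ + _).
rewrite addrC -big_split big1 //= => u evu.
have := congr1 (fun A : {set _} => (v, u) \in A) eqA; rewrite !inE evu /=.
have [->|neq' _] := eqVneq (w' u) (w' v).
  by move/esym/negbFE/eqP->; rewrite !subrr.
by rewrite (potential_eq_alternates eq_pot evu neq') addNr.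
Qed.

End Diffusion.

Theorem theorem1p1 (n : nat) (hn : (0 < n)%N) (e : rel 'I_n)
    (e_sym : symmetric e) (e_irr : irreflexive e) (w0 : config n) :
  exists p : nat, (p = 1%N \/ p = 2%N) /\
    exists T : nat, forall t : nat, (T <= t)%N ->
      diffusion e w0 (t + p)%N = diffusion e w0 t.
Proof.
(* The value 2 also covers the case where the process reaches a fixed point. *)
exists 2%N; split; first by right.
have [T0 eq_pot] := nonincreasing_int_stable
  (fun t => potential_bound e (diffusion e w0 t))
  (fun t => potential_le e_sym (diffusion e w0 t)).
have subA t : (T0 <= t)%N ->
    active_edges e (diffusion e w0 t.+1) \subset active_edges e (diffusion e w0 t).
  by move/eq_pot/(potential_eq_active e_sym).
(* Time is shifted by [T0], since the active sets are only known to shrink from then on. *)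
have [|T1 eqA] :=
    @nonincreasing_nat_stable (fun t => #|active_edges e (diffusion e w0 (t + T0))|).
  by move=> t; rewrite addSn subset_leq_card // subA // leq_addl.
exists (T1 + T0)%N => t le_t; rewrite addn2.
have le_t0 : (T0 <= t)%N by apply: leq_trans le_t; apply: leq_addl.
apply: (active_eq_period2 e_sym); first exact: eq_pot.
(* Nested finite sets of equal cardinality coincide. *)
apply/eqP; rewrite eqEcard subA //=.
have := eqA (t - T0)%N; rewrite addSn subnK // => -> //.
by rewrite leq_subRL // addnC.
Qed.
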